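(* Let $a,b,c\in\mathbb{R}$ and $\lambda>0$ be such that $l:=2a+b^2+\lambda c(2+c)<0$. Then, for a stepsize $\Delta t>0$, the tamed Euler scheme applied to the linear test equation $$dX(t)=aX(t^-)dt+bX(t^-)dW(t)+cX(t^-)dN(t),\qquad X(0)=X_0,$$ is mean-square stable if one of the following conditions is satisfied: \begin{itemize} \item $a(1+\lambda c\Delta t)\le0$, $2a-l>0$ and $\Delta t<\dfrac{2a-l}{a^2+\lambda^2c^2}$; \item $a(1+\lambda c\Delta t)>0$ and $\Delta t<\dfrac{-l}{(a+\lambda c)^2}$. \end{itemize}
   Context: $W$ is a scalar Brownian motion and $N$ a scalar Poisson process with intensity $\lambda$, on a common filtered probability space $(\Omega,\mathcal{F},(\mathcal{F}_t)_{t\ge 0},\mathbb{P})$ with respect to which both are adapted with increments independent of the past; $X_0$ is $\mathcal{F}_0$-measurable, real-valued, with $\mathbb{E}|X_0|^2<\infty$. The tamed Euler scheme applied to the linear test equation is, for $n\ge0$, $$X_{n+1}=X_n+\frac{aX_n\Delta t}{1+\Delta t|aX_n|}+bX_n\Delta W_n+cX_n\Delta N_n,$$ started from $X_0$, with $\Delta W_n=W((n+1)\Delta t)-W(n\Delta t)$ and $\Delta N_n=N((n+1)\Delta t)-N(n\Delta t)$. The scheme with stepsize $\Delta t$ is called mean-square stable if there exists a constant $0<L<1$ such that, for every such initial value $X_0$, $\mathbb{E}|X_{n+1}|^2\le L\,\mathbb{E}|X_n|^2$ for all $n\ge 0$. *)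

(* Defs.v *)
From HB Require Import structures.
From mathcomp Require Import all_boot all_order all_algebra.
From mathcomp Require Import all_classical all_reals all_analysis.

Set Implicit Arguments.
Unset Strict Implicit.
Unset Printing Implicit Defensive.

Import Order.TTheory GRing.Theory Num.Theory.
Import numFieldNormedType.Exports.

Local Open Scope classical_set_scope.
Local Open Scope ring_scope.

Section stochastic_basis.
Context {R : realType} {d : measure_display} {T : measurableType d}.
Variable P : probability T R.
Implicit Types (G : set (set T)) (F : R -> set (set T)).

(* Time is [0, +oo[ inside R: nothing is required at negative times. *)
Record filtration F : Prop := Filtration {
  filtration_sigma : forall t, 0 <= t -> sigma_algebra [set: T] (F t) ;
  filtration_sub : forall t, 0 <= t -> F t `<=` measurable ;
  filtration_le : forall s t, 0 <= s -> s <= t -> F s `<=` F t }.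

Definition measurable_wrt G (X : T -> R) : Prop :=
  forall B : set R, measurable B -> G (X @^-1` B).

Definition adapted F (Z : R -> T -> R) : Prop :=
  forall t, 0 <= t -> measurable_wrt (F t) (Z t).

Definition independent_of G (X : T -> R) : Prop :=
  forall (A : set T) (B : set R), G A -> measurable B ->
    P (A `&` X @^-1` B) = (P A * P (X @^-1` B))%E.

Definition increment (Z : R -> T -> R) (s t : R) : T -> R :=
  fun w => Z t w - Z s w.

Definition increments_independent_of_past F (Z : R -> T -> R) : Prop :=
  forall s t, 0 <= s -> s < t -> independent_of (F s) (increment Z s t).

(* The second parameter of normal_prob is the standard deviation. *)
Record brownian_motion F (W : R -> T -> R) : Prop := BrownianMotion {
  brownian0 : {ae P, forall w, W 0 w = 0} ;
  brownian_adapted : adapted F W ;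
  brownian_indep : increments_independent_of_past F W ;
  brownian_normal : forall s t, 0 <= s -> s < t ->
    forall B : set R, measurable B ->
      P (increment W s t @^-1` B) = normal_prob 0 (Num.sqrt (t - s)) B ;
  brownian_continuous :
    {ae P, forall w, {within [set t | 0 <= t], continuous (W ^~ w)}} }.

Definition real_valued (N : R -> T -> nat) : R -> T -> R :=
  fun t w => (N t w)%:R.

(* Left limits need not be required: a nondecreasing path with values in nat
   has them. *)
Record poisson_process F (lambda : R) (N : R -> T -> nat) : Prop :=
  PoissonProcess {
  poisson0 : {ae P, forall w, N 0 w = 0%N} ;
  poisson_adapted : adapted F (real_valued N) ;
  poisson_indep : increments_independent_of_past F (real_valued N) ;
  poisson_law : forall s t, 0 <= s -> s < t -> forall k : nat,
    P (increment (real_valued N) s t @^-1` [set k%:R]) =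
      (poisson_pmf (lambda * (t - s)) k)%:E ;
  poisson_nondecreasing :
    {ae P, forall w, forall s t, 0 <= s -> s <= t -> (N s w <= N t w)%N} ;
  poisson_right_continuous : {ae P, forall w, forall t, 0 <= t ->
    real_valued N s w @[s --> t^'+] --> real_valued N t w} }.

Fixpoint tamed_euler (W : R -> T -> R) (N : R -> T -> nat) (a b c dt : R)
    (X0 : T -> R) (n : nat) : T -> R :=
  if n is m.+1 then fun w =>
    let x := tamed_euler W N a b c dt X0 m w in
    let dW := increment W (m%:R * dt) (m.+1%:R * dt) w in
    let dN := increment (real_valued N) (m%:R * dt) (m.+1%:R * dt) w in
    x + a * x * dt / (1 + dt * `|a * x|) + b * x * dW + c * x * dN
  else X0.

(* L is chosen before the initial value: it is uniform in X0 and in n. *)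
Definition mean_square_stable F (scheme : (T -> R) -> nat -> T -> R) : Prop :=
  exists L : R, 0 < L < 1 /\
    forall X0 : T -> R, measurable_wrt (F 0) X0 ->
      ('E_P[fun w => (`|X0 w| ^+ 2)%R] < +oo)%E ->
      forall n : nat,
        ('E_P[fun w => (`|scheme X0 n.+1 w| ^+ 2)%R] <=
         L%:E * 'E_P[fun w => (`|scheme X0 n w| ^+ 2)%R])%E.

End stochastic_basis.

(* Main.v *)
Require Import Defs.
From HB Require Import structures.
From mathcomp Require Import all_boot all_order all_algebra.
From mathcomp Require Import all_classical all_reals all_analysis.
From mathcomp Require Import measurable_realfun ring lra.

Import Order.TTheory GRing.Theory Num.Theory.
Import numFieldNormedType.Exports.

(** The step of the scheme reads [X' = G + b X U + c X K], where [G] is the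
    tamed drift part, [U] the Brownian increment and [K] the Poisson increment
    of the step. Expand [X' ^ 2] and take expectations. The weights [G ^ 2],
    [G X], [X ^ 2] belong to the past, so independence factors each
    expectation, and only [E U = 0], [E (U ^ 2) <= dt], [E K = lambda dt] and
    [E (K ^ 2) = lambda dt + (lambda dt) ^ 2] enter, except in the cross term
    [2 b c E (X ^ 2 U K)]. What is left is at most the expectation of
    [X ^ 2] times a quadratic polynomial in the taming number
    [th = 1 / (1 + dt |a X|)] of [[0, 1]]; either condition on the stepsize
    keeps the polynomial below a constant [L < 1] ([amplification_lt1],
    [tamed_euler_second_moment_step]).

    The cross term is the delicate point: the two noises are driven by the same
    filtration but nothing says that they are independent of each other. It
    vanishes nevertheless ([integral_weighted_product_eq0]), because a
    continuous and a pure jump process have no covariation. For a past weight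
    [Y], the number [phi (s, t) = E (Y U K)], with [U], [K] the increments over
    [[s, t]], is additive in the interval: the mixed terms pair a centred
    increment with its past, or an increment of nonzero mean with a past weight
    of mean zero. On a short interval [phi] is of smaller order than
    the length: [K] is integer-valued, so that [|U K|] is at most
    [U ^ 4 / e ^ 3 + e K ^ 2] for every [e > 0], and [E (U ^ 4)] is of order
    [(t - s) ^ 2]. Cutting [[s, t]] into [n] equal pieces and letting first [n]
    go to infinity and then [e] to [0] gives [phi = 0].

    The normal moments come from the moment generating function alone. Tilting
    the density by [expR (u x)] completes a square, which gives
    [E (expR (u U)) = expR (u ^ 2 s ^ 2 / 2)]; comparing with polynomial lower
    bounds of exponentials gives the mean and upper bounds of the second and
    fourth moments. The Poisson moments come from the recurrence
    [(k + 1) p (k + 1) = r p k] of the mass function. *)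

Local Open Scope classical_set_scope.
Local Open Scope ring_scope.

Set Implicit Arguments.
Unset Strict Implicit.

(** * Expectation of a product with an independent factor *)

Section real_integrable.
Context {R : realType} {d : measure_display} {T : measurableType d}.
Variable mu : {measure set T -> \bar R}.
Implicit Types f g : T -> R.

Lemma integrable_addr f g :
  mu.-integrable setT (EFin \o f) -> mu.-integrable setT (EFin \o g) ->
  mu.-integrable setT (EFin \o (fun w => f w + g w)).
Proof. by move=> fi gi; exact: (integrableD measurableT fi gi). Qed.

Lemma integrable_scaler (k : R) f : mu.-integrable setT (EFin \o f) ->
  mu.-integrable setT (EFin \o (fun w => k * f w)).
Proof. by move=> fi; exact: (integrableZl measurableT k fi). Qed.

Lemma dominated_integrable f g : measurable_fun setT f ->
  mu.-integrable setT (EFin \o g) -> (forall w, `|f w| <= g w) ->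
  mu.-integrable setT (EFin \o f).
Proof.
move=> mf gi fg; apply: (le_integrable measurableT _ _ gi).
  exact/measurable_EFinP.
by move=> w _; rewrite lee_fin; exact: le_trans (fg w) (ler_norm _).
Qed.

Lemma integrable_measurable f :
  mu.-integrable setT (EFin \o f) -> measurable_fun setT f.
Proof. by move=> fi; exact/measurable_EFinP/(measurable_int mu). Qed.

End real_integrable.

(** Independence says that the joint law of [Y] and [Z] agrees with the product
    of the two laws on rectangles, hence everywhere. Tonelli's theorem under
    that product gives the integrability of [Y Z], Fubini's its expectation. *)
Lemma independent_integrableM (R : realType) (d : measure_display)
    (T : measurableType d) (P : probability T R) (G : set (set T))
    (Y Z : T -> R) :
  G `<=` measurable -> measurable_wrt G Y -> independent_of P G Z ->
  P.-integrable setT (EFin \o Y) -> P.-integrable setT (EFin \o Z) ->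
  P.-integrable setT (EFin \o (fun w => Y w * Z w)) /\
  \int[P]_w (Y w * Z w) = (\int[P]_w Y w) * (\int[P]_w Z w).
Proof.
move=> Gm mGY indZ iY iZ.
have mY : measurable_fun setT Y by apply/measurable_EFinP/(measurable_int P).
have mZ : measurable_fun setT Z by apply/measurable_EFinP/(measurable_int P).
pose RY : {mfun T >-> R} := mfun_Sub (mem_set mY).
pose RZ : {mfun T >-> R} := mfun_Sub (mem_set mZ).
have mYZ : measurable_fun setT (fun w => (Y w, Z w)).
  exact: measurable_fun_pair.
pose RYZ : {mfun T >-> (R * R)%type} := mfun_Sub (mem_set mYZ).
pose PY := distribution P RY; pose PZ := distribution P RZ.
have joint (A : set (R * R)) : measurable A ->
    (PY \x PZ)%E A = distribution P RYZ A.
  apply: product_measure_unique => U V mU mV.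
  rewrite /= /distribution /pushforward /=.
  have -> : (fun w => (Y w, Z w)) @^-1` (U `*` V) = Y @^-1` U `&` Z @^-1` V.
    by [].
  exact: indZ (mGY _ mU) mV.
have mmul : measurable_fun setT (fun z : R * R => (z.1 * z.2)%:E).
  apply/measurable_EFinP; exact: measurable_funM.
have tonelli : (\int[P]_w `|(Y w * Z w)%:E| =
    (\int[P]_w `|(Y w)%:E|) * (\int[P]_w `|(Z w)%:E|))%E.
  transitivity (\int[distribution P RYZ]_z `|(z.1 * z.2)%:E|)%E.
    by rewrite ge0_integral_distribution//; exact: measurableT_comp.
  transitivity (\int[(PY \x PZ)%E]_z `|(z.1 * z.2)%:E|)%E.
    by apply: eq_measure_integral => A mA _; exact/esym/joint.
  rewrite (fubini_tonelli1 (m1 := PY) (m2 := PZ)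
    (fun z => `|(z.1 * z.2)%:E|)%E)//; last exact: measurableT_comp.
  have iZE : (\int[PZ]_y `|y%:E| = \int[P]_w `|(Z w)%:E|)%E.
    by rewrite ge0_integral_distribution//; exact: measurableT_comp.
  transitivity (\int[PY]_x (`|x%:E| * \int[P]_w `|(Z w)%:E|))%E.
    apply: eq_integral => x _ /=.
    rewrite /fubini_F /=.
    under eq_integral do rewrite normrM EFinM.
    rewrite ge0_integralZl_EFin// -?iZE//.
    by apply/measurable_EFinP; exact: normr_measurable.
  rewrite ge0_integralZr//; last 2 first.
  - by apply: measurableT_comp => //; exact: EFin_measurable.
  - exact: integral_ge0.
  rewrite ge0_integral_distribution//.
  by apply: measurableT_comp => //; exact: EFin_measurable.
have iYZ : P.-integrable setT (EFin \o (fun w => Y w * Z w)).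
  apply/integrableP; split.
    by apply/measurable_EFinP; exact: measurable_funM.
  rewrite tonelli; apply: lte_mul_pinfty; first exact: integral_ge0.
    rewrite ge0_fin_numE; last exact: integral_ge0.
    by case/integrableP : iY.
  by case/integrableP : iZ.
split=> //.
have iP : (PY \x PZ)%E.-integrable setT (fun z : R * R => (z.1 * z.2)%:E).
  apply/integrableP; split=> //.
  have -> : (\int[(PY \x PZ)%E]_z `|(z.1 * z.2)%:E| =
      \int[distribution P RYZ]_z `|(z.1 * z.2)%:E|)%E.
    by apply: eq_measure_integral => A mA _; exact: joint.
  rewrite ge0_integral_distribution//; last exact: measurableT_comp.
  by case/integrableP : iYZ.
have fE : (\int[P]_w (Y w * Z w)%:E =
    (\int[P]_w (Y w)%:E) * (\int[P]_w (Z w)%:E))%E.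
  transitivity (\int[distribution P RYZ]_z (z.1 * z.2)%:E)%E.
    by rewrite integral_distribution.
  transitivity (\int[(PY \x PZ)%E]_z (z.1 * z.2)%:E)%E.
    by apply: eq_measure_integral => A mA _; exact/esym/joint.
  rewrite -(integral12_prod_meas1 (m1 := PY) (m2 := PZ) iP).
  have iZ' : PZ.-integrable setT EFin.
    by apply: integrable_pushforward => //; exact: EFin_measurable.
  have iZE : (\int[PZ]_y y%:E = \int[P]_w (Z w)%:E)%E.
    by rewrite integral_distribution.
  transitivity (\int[PY]_x (x%:E * \int[P]_w (Z w)%:E))%E.
    apply: eq_integral => x _ /=.
    rewrite /fubini_F /=.
    under eq_integral do rewrite EFinM.
    by rewrite integralZl// -iZE.
  have finZ : (\int[P]_w (Z w)%:E)%E \is a fin_num by exact: integrable_fin_num.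
  rewrite -(fineK finZ) integralZr//; last first.
    by apply: integrable_pushforward => //; exact: EFin_measurable.
  by rewrite integral_distribution.
by rewrite /Rintegral fE fineM//; exact: integrable_fin_num.
Qed.

(** * Moments of a centred normal law *)

(** The Radon-Nikodym derivative of the normal law is its density almost
    everywhere, so the change of variables along the former transfers to the
    latter. *)
Lemma ge0_integral_normal_prob (R : realType) (m s : R)
    (f : measurableTypeR R -> \bar R) :
  measurable_fun setT f -> (forall x, (0 <= f x)%E) ->
  (\int[normal_prob m s]_x f x =
   \int[lebesgue_measure]_x (f x * (normal_pdf m s x)%:E))%E.
Proof.
move=> mf f0.
have dom := normal_prob_dominates m s.
rewrite -(Radon_Nikodym_SigmaFinite.change_of_variables dom f0)//.
have mrn := measurable_int _ (Radon_Nikodym_SigmaFinite.f_integrable dom).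
have mpdf : measurable_fun setT (fun x => (normal_pdf m s x)%:E).
  by apply/measurable_EFinP; exact: measurable_normal_pdf.
apply: ae_eq_integral => //.
- exact: emeasurable_funM.
- exact: emeasurable_funM.
- apply: ae_eqe_mul2l; apply: integral_ae_eq => //.
  + exact: Radon_Nikodym_SigmaFinite.f_integrable.
  + by move=> A _ mA; rewrite -Radon_Nikodym_SigmaFinite.f_integral.
Qed.

(** Completing the square: tilting the centred normal density by [expR (u * x)]
   gives, up to a constant, the normal density of mean [u * s ^+ 2]. *)
Lemma integral_expR_normal_prob (R : realType) (s u : R) : s != 0 ->
  (\int[normal_prob 0 s]_x (expR (u * x))%:E =
   (expR (u ^+ 2 * s ^+ 2 / 2))%:E)%E.
Proof.
move=> s0.
rewrite ge0_integral_normal_prob//; last first.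
  by apply/measurable_EFinP/measurableT_comp => //; exact: measurable_funM.
have tilt x : ((expR (u * x))%:E * (normal_pdf 0 s x)%:E =
    (expR (u ^+ 2 * s ^+ 2 / 2))%:E * (normal_pdf (u * s ^+ 2) s x)%:E)%E.
  rewrite !normal_pdfE// /normal_fun -!EFinM; congr EFin.
  rewrite mulrCA [RHS]mulrCA -!expRD; congr (_ * expR _).
  by field.
under eq_integral do rewrite tilt.
rewrite integralZl//; last exact: integrable_normal_pdf.
by rewrite integral_normal_pdf mule1.
Qed.

(** With [y = 2 z] the right-hand side is the square of
    [expR z - expR (- z)], and [2 z <= expR z - expR (- z)] follows from the
    quadratic lower bound of [expR z]. *)
Lemma cosh_ge_quadratic (R : realType) (y : R) :
  y ^+ 2 <= expR y + expR (- y) - 2.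
Proof.
wlog y0 : y / 0 <= y => [ih|].
  have [/ih//|/ltW y0] := leP 0 y.
  have := ih (- y); rewrite oppr_ge0 opprK sqrrN => /(_ y0).
  by rewrite [expR (- y) + _]addrC.
pose z := y / 2; have z0 : 0 <= z by rewrite divr_ge0.
have -> : y = z + z by rewrite /z; lra.
rewrite opprD !expRD.
have qp : expR z * expR (- z) = 1 by rewrite -expRD subrr expR0.
have pge : 1 + z + z ^+ 2 / 2 <= expR z.
  have -> : 1 + z + z ^+ 2 / 2 = series (exp_coeff z) 3.
    rewrite /series /= /exp_coeff /= big_mkord !big_ord_recr big_ord0 /=.
    by rewrite !factS fact0; field.
  apply: nondecreasing_cvgn_le; last exact: is_cvg_series_exp_coeff.
  apply/nondecreasing_seqP => n; rewrite /series /= big_nat_recr//= lerDl.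
  by rewrite /exp_coeff /= divr_ge0// exprn_ge0.
have q0 : 0 < expR (- z) by exact: expR_gt0.
have p0 : 0 < expR z by exact: expR_gt0.
suff : 2 * z <= expR z - expR (- z) by nra.
move: (expR z) (expR (- z)) qp pge q0 p0 => p q qp pge q0 p0.
have qP : q * (1 + z + z ^+ 2 / 2) <= 1.
  by rewrite -[leRHS]qp [leRHS]mulrC ler_pM2l.
suff : q <= 1 - z + z ^+ 2 / 2 by lra.
have P0 : 0 < 1 + z + z ^+ 2 / 2 by nra.
rewrite -(ler_pM2r P0); apply: le_trans qP _.
have -> : (1 - z + z ^+ 2 / 2) * (1 + z + z ^+ 2 / 2) = 1 + (z ^+ 2) ^+ 2 / 4.
  by field.
by rewrite lerDl divr_ge0// sqr_ge0.
Qed.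

(** Squaring the quadratic bound at [2 z] gives a quartic one, up to the
    inequality between a square of a sum and the sum of the squares. *)
Lemma cosh_ge_quartic (R : realType) (z : R) :
  z ^+ 4 <= (expR (4 * z) + expR (- (4 * z))) / 2.
Proof.
have h := cosh_ge_quadratic (2 * z).
have -> : expR (4 * z) = expR (2 * z) ^+ 2.
  by rewrite -expRM_natl; congr expR; ring.
have -> : expR (- (4 * z)) = expR (- (2 * z)) ^+ 2.
  by rewrite -expRM_natl; congr expR; ring.
have := expR_ge0 (2 * z); have := expR_ge0 (- (2 * z)).
move: (expR (2 * z)) (expR (- (2 * z))) h => p q h p0 q0.
have : 0 <= z ^+ 2 by exact: sqr_ge0.
have -> : z ^+ 4 = (z ^+ 2) ^+ 2 by ring.
have : 4 * z ^+ 2 <= p + q by move: h; rewrite exprMn; lra.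
move: (z ^+ 2) => t t0 ht.
have : 0 <= (p + q - 4 * t) * (p + q + 4 * t) by apply: mulr_ge0; lra.
have := sqr_ge0 (p - q); have := sqr_ge0 (p + q); nra.
Qed.

Lemma gaussian_expR_moment (R : realType) (d : measure_display)
    (T : measurableType d) (P : probability T R) (X : T -> R) (s u : R) :
  s != 0 -> measurable_fun setT X ->
  (forall B, measurable B -> P (X @^-1` B) = normal_prob 0 s B) ->
  P.-integrable setT (EFin \o (fun w => expR (u * X w))) /\
  \int[P]_w expR (u * X w) = expR (u ^+ 2 * s ^+ 2 / 2).
Proof.
move=> s0 mX lawX.
pose RX : {mfun T >-> measurableTypeR R} := 
  @mfun_Sub _ _ T (measurableTypeR R) X (mem_set mX).
have mexp : measurable_fun setT (fun x : R => (expR (u * x))%:E).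
  by apply/measurable_EFinP/measurableT_comp => //; exact: measurable_funM.
have E : (\int[P]_w (expR (u * X w))%:E = (expR (u ^+ 2 * s ^+ 2 / 2))%:E)%E.
  rewrite -integral_expR_normal_prob//.
  transitivity (\int[distribution P RX]_x (expR (u * x))%:E)%E.
    by rewrite ge0_integral_distribution// => x; rewrite lee_fin expR_ge0.
  by apply: eq_measure_integral => A mA _; exact: lawX.
split; last by rewrite /Rintegral E.
apply/integrableP; split.
  by apply/measurable_EFinP/measurableT_comp => //; exact: measurable_funM.
under eq_integral do rewrite /= ger0_norm ?expR_ge0//.
by rewrite E ltry.
Qed.

(** Only the mean has to be exact; upper bounds are enough for the other two
    moments. All three are read off the moment generating function: the first
    from [1 + x <= expR x], the second from [cosh_ge_quadratic], both with a
    small parameter, and the fourth from [cosh_ge_quartic] at [X / s], where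
    [expR 8 = expR (4 ^ 2 / 2)]. *)
Lemma gaussian_moments (R : realType) (d : measure_display)
    (T : measurableType d) (P : probability T R) (X : T -> R) (s : R) :
  0 < s -> measurable_fun setT X ->
  (forall B, measurable B -> P (X @^-1` B) = normal_prob 0 s B) ->
  [/\ P.-integrable setT (EFin \o X) /\ \int[P]_w X w = 0,
      P.-integrable setT (EFin \o (fun w => X w ^+ 2)) /\
        \int[P]_w (X w ^+ 2) <= s ^+ 2 &
      P.-integrable setT (EFin \o (fun w => X w ^+ 4)) /\
        \int[P]_w (X w ^+ 4) <= expR 8 * s ^+ 4].
Proof.
move=> s0 mX lawX.
have iE u : P.-integrable setT (EFin \o (fun w => expR (u * X w))).
  by have [] := gaussian_expR_moment u (lt0r_neq0 s0) mX lawX.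
have E u : \int[P]_w expR (u * X w) = expR (u ^+ 2 * s ^+ 2 / 2).
  by have [] := gaussian_expR_moment u (lt0r_neq0 s0) mX lawX.
have icst k : P.-integrable setT (EFin \o (fun=> k)).
  exact: finite_measure_integrable_cst.
have Ecst k : \int[P]_w k = k.
  rewrite Rintegral_cst//= probability_setT/= mulr1//.
have iC u : P.-integrable setT
    (EFin \o (fun w => expR (u * X w) + expR (- u * X w))).
  exact: integrable_addr.
have EC u : \int[P]_w (expR (u * X w) + expR (- u * X w)) =
    2 * expR (u ^+ 2 * s ^+ 2 / 2).
  by rewrite RintegralD// !E sqrrN mulr_natl mulr2n.
(* Multiplying a bound by [1 - v] replaces [expR v] by [1], so that the
   exponentials on the right never have to be expanded. *)
have expv (v : R) : expR v * (1 - v) <= 1.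
  rewrite -[leRHS](expRxMexpNx_1 v) ler_pM2l ?expR_gt0//.
  exact: expR_ge1Dx.
have iX2 : P.-integrable setT (EFin \o (fun w => X w ^+ 2)).
  apply: dominated_integrable (iC 1) _; first exact: measurable_funX.
  move=> w; rewrite ger0_norm ?sqr_ge0// mul1r mulN1r.
  by apply: le_trans (cosh_ge_quadratic _) _; lra.
have iX : P.-integrable setT (EFin \o X).
  apply: dominated_integrable (integrable_addr (icst 1) iX2) _ => //.
  move=> w; rewrite -[X w ^+ 2]real_normK ?num_real//.
  by have := sqr_ge0 (`|X w| - 1); nra.
have iX4 : P.-integrable setT (EFin \o (fun w => X w ^+ 4)).
  apply: dominated_integrable (iC 4) _; first exact: measurable_funX.
  move=> w; rewrite (ger0_norm (exprn_even_ge0 _ _))// mulNr.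
  have := cosh_ge_quartic (X w); have := expR_ge0 (4 * X w).
  by have := expR_ge0 (- (4 * X w)); lra.
have m1 u : u ^+ 2 * s ^+ 2 <= 2 ->
    u * \int[P]_w X w * (1 - u ^+ 2 * s ^+ 2 / 2) <= u ^+ 2 * s ^+ 2 / 2.
  move=> us2.
  have h : 1 + u * \int[P]_w X w <= expR (u ^+ 2 * s ^+ 2 / 2).
    rewrite -E -RintegralZl// -[X in X + _ <= _]Ecst -RintegralD//; last first.
      exact: integrable_scaler.
    apply: le_Rintegral => //; first exact/integrable_addr/integrable_scaler.
    by move=> w _; exact: expR_ge1Dx.
  have := expv (u ^+ 2 * s ^+ 2 / 2).
  have v1 : 0 <= 1 - u ^+ 2 * s ^+ 2 / 2 by lra.
  have := ler_wpM2r v1 h; lra.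
have m2 u : 0 < u -> u ^+ 2 * s ^+ 2 <= 2 ->
    \int[P]_w (X w ^+ 2) * (1 - u ^+ 2 * s ^+ 2 / 2) <= s ^+ 2.
  move=> u0 us2.
  have h : 2 + u ^+ 2 * \int[P]_w (X w ^+ 2) <= 2 * expR (u ^+ 2 * s ^+ 2 / 2).
    rewrite -EC -RintegralZl// -[X in X + _ <= _]Ecst -RintegralD//; last first.
      exact: integrable_scaler.
    apply: le_Rintegral => //; first exact/integrable_addr/integrable_scaler.
    move=> w _; have := cosh_ge_quadratic (u * X w).
    by rewrite exprMn mulNr; lra.
  have := expv (u ^+ 2 * s ^+ 2 / 2).
  have v1 : 0 <= 1 - u ^+ 2 * s ^+ 2 / 2 by lra.
  have := ler_wpM2r v1 h => h1 h2.
  rewrite -(ler_pM2l (exprn_gt0 2 u0)); lra.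
split; split=> //.
- apply/eqP; apply: contraT => m0.
  set m := \int[P]_w X w in m0 m1.
  have mm0 : 0 < m ^+ 2 by rewrite exprn_even_gt0.
  have ss0 : 0 < s ^+ 2 by rewrite exprn_gt0.
  (* To leading order, the bound [m1] at [u = t * m] is linear in [t] on the
     left and quadratic on the right; this [t] is small enough to contradict
     it. *)
  pose D := 1 + s ^+ 2 + m ^+ 2.
  have D0 : 0 < D by rewrite /D; lra.
  pose t := D^-1; have t0 : 0 < t by rewrite invr_gt0.
  have tm : t * m ^+ 2 <= 1 by rewrite ler_pdivrMl// /D; lra.
  have ts : t * s ^+ 2 < 1 by rewrite ltr_pdivrMl// /D; lra.
  have Ev : (t * m) ^+ 2 * s ^+ 2 = (t * m ^+ 2) * (t * s ^+ 2) by ring.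
  have := m1 (t * m).
  have -> : t * m * m = t * m ^+ 2 by ring.
  rewrite Ev.
  move: (t * m ^+ 2) (t * s ^+ 2) tm ts (mulr_gt0 t0 mm0) (mulr_gt0 t0 ss0).
  move=> x y x1 y1 x0 y0 h.
  have xy : x * y <= y by rewrite ler_piMl// ltW.
  have /h : x * y <= 2 by lra.
  have xyx : x * (1 - x * y / 2 - y / 2) <= 0 -> 1 - x * y / 2 - y / 2 <= 0.
    by rewrite pmulr_rle0.
  move=> hxy; have /xyx : x * (1 - x * y / 2 - y / 2) <= 0 by lra.
  lra.
- rewrite leNgt; apply/negP => gt.
  set M := \int[P]_w (X w ^+ 2) in gt m2.
  have ss0 : 0 < s ^+ 2 by rewrite exprn_gt0.
  have M0 : 0 < M by lra.
  (* The square of the parameter that makes the left-hand side of [m2] equal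
     to the midpoint of [M] and [s ^+ 2]. *)
  pose q := (M - s ^+ 2) / (M * s ^+ 2).
  have q0 : 0 < q by rewrite divr_gt0 ?mulr_gt0 ?subr_gt0.
  have qE : q * s ^+ 2 * M = M - s ^+ 2 by rewrite /q; field; rewrite !gt_eqF.
  have := m2 (Num.sqrt q); rewrite sqr_sqrtr ?(ltW q0)// sqrtr_gt0 => /(_ q0).
  nra.
- have -> : \int[P]_w (X w ^+ 4) = s ^+ 4 * \int[P]_w ((s^-1 * X w) ^+ 4).
    rewrite -RintegralZl//; last first.
      under eq_fun do rewrite exprMn.
      exact: (integrable_scaler (s^-1 ^+ 4)).
    by apply: eq_Rintegral => w _; field; rewrite gt_eqF.
  rewrite mulrC ler_pM2r ?exprn_gt0//.
  have -> : expR 8 =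
      2^-1 * \int[P]_w (expR (4 / s * X w) + expR (- (4 / s) * X w)).
    rewrite EC; have -> : (4 / s) ^+ 2 * s ^+ 2 / 2 = 8 by field; rewrite gt_eqF.
    lra.
  rewrite -RintegralZl//; apply: le_Rintegral => //.
  - under eq_fun do rewrite exprMn.
    exact: (integrable_scaler (s^-1 ^+ 4)).
  - exact: integrable_scaler.
  - move=> w _; have := cosh_ge_quartic (s^-1 * X w).
    have -> : 4 / s * X w = 4 * (s^-1 * X w) by rewrite mulrA.
    have -> : - (4 / s) * X w = - (4 * (s^-1 * X w)) by ring.
    lra.
Qed.

(** * Moments of a Poisson law *)

Lemma nneseries_poisson_pmf (R : realType) (r : R) : 0 < r ->
  (\sum_(0 <= k <oo) (poisson_pmf r k)%:E = 1)%E.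
Proof.
move=> r0; have := probability_setT (poisson_prob r 0).
rewrite /= /poisson_prob r0 => <-.
by rewrite nneseries_esumT// => k; rewrite lee_fin poisson_pmf_ge0.
Qed.

(** Both Poisson moments are instances of this form of the recurrence
    [(k + 1) p (k + 1) = r p k], with [h = 1] and [h k = k]. *)
Lemma nneseries_poisson_pmf_shift (R : realType) (r : R) (h : nat -> R) :
  0 < r -> (forall k, 0 <= h k) ->
  (\sum_(0 <= k <oo) (k%:R * h k * poisson_pmf r k)%:E =
   r%:E * \sum_(0 <= k <oo) (h k.+1 * poisson_pmf r k)%:E)%E.
Proof.
move=> r0 h0.
rewrite nneseries_recl//; last first.
  by move=> k _; rewrite lee_fin !mulr_ge0// poisson_pmf_ge0.
rewrite !mul0r add0e -nneseries_addn; last first.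
  by move=> k; rewrite lee_fin !mulr_ge0// poisson_pmf_ge0.
rewrite -nneseriesZl; last first.
  by move=> k _; rewrite lee_fin mulr_ge0// poisson_pmf_ge0.
apply: eq_eseriesr => k _; rewrite -EFinM; congr EFin.
rewrite addn1 /poisson_pmf r0 factS natrM exprS.
by field; rewrite nat1r !pnatr_eq0 -!lt0n fact_gt0.
Qed.

(** The Poisson masses add up to [1], so the points outside the events
    [V = k] form a null set and the integral splits over these events. *)
Lemma ge0_integral_poisson_law (R : realType) (d : measure_display)
    (T : measurableType d) (P : probability T R) (V : T -> R) (r : R)
    (f : R -> R) :
  0 < r -> measurable_fun setT V ->
  (forall k, P (V @^-1` [set k%:R]) = (poisson_pmf r k)%:E) ->
  measurable_fun setT f -> (forall x, 0 <= f x) ->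
  (\int[P]_w (f (V w))%:E =
   \sum_(0 <= k <oo) (f k%:R * poisson_pmf r k)%:E)%E.
Proof.
move=> r0 mV lawV mf f0.
pose A k := V @^-1` [set k%:R].
have mA k : measurable (A k) by rewrite -[A k]setTI; exact: mV.
have tA : trivIset setT A.
  move=> i j _ _ [w [/= Vi Vj]].
  by apply/eqP; rewrite -(eqr_nat R) -Vi -Vj.
have mU : measurable (\bigcup_k A k) by exact: bigcup_measurable.
have PU : P (\bigcup_k A k) = 1%E.
  rewrite measure_bigcup//.
  rewrite -(nneseries_poisson_pmf r0).
  rewrite (eq_eseriesl (Q := xpredT)); last by move=> k; rewrite in_setT.
  by apply: eq_eseriesr => k _; exact: lawV.
have PUC : P (~` \bigcup_k A k) = 0%E by rewrite probability_setC// PU subee.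
have mfV : measurable_fun setT (EFin \o (f \o V)).
  by apply/measurable_EFinP; exact: measurableT_comp.
rewrite (@ge0_negligible_integral _ _ _ P setT (~` \bigcup_k A k))//;
  last 2 first.
- exact: measurableC.
- by move=> w _; rewrite lee_fin.
rewrite setTD setCK ge0_integral_bigcup//; last 2 first.
- exact: measurable_funTS.
- by move=> w _; rewrite lee_fin.
apply: eq_eseriesr => k _.
transitivity (\int[P]_(w in A k) cst (f k%:R)%:E w)%E.
  by apply: eq_integral => w /set_mem /= ->.
by rewrite integral_cst// EFinM -lawV.
Qed.

Lemma poisson_moments (R : realType) (d : measure_display)
    (T : measurableType d) (P : probability T R) (V : T -> R) (r : R) :
  0 < r -> measurable_fun setT V ->
  (forall k, P (V @^-1` [set k%:R]) = (poisson_pmf r k)%:E) ->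
  [/\ P.-integrable setT (EFin \o V), \int[P]_w V w = r,
      P.-integrable setT (EFin \o (fun w => V w ^+ 2)) &
      \int[P]_w (V w ^+ 2) = r + r ^+ 2].
Proof.
move=> r0 mV lawV.
have formula := @ge0_integral_poisson_law _ _ _ P V r _ r0 mV lawV.
have Eabs : (\int[P]_w (`|V w|)%:E = r%:E)%E.
  rewrite (formula (fun x => `|x|)).
  - under eq_eseriesr do rewrite normr_nat -[X in X * _]mulr1.
    rewrite (@nneseries_poisson_pmf_shift _ r (fun=> 1))//.
    under eq_eseriesr do rewrite mul1r.
    by rewrite nneseries_poisson_pmf// mule1.
  - exact: normr_measurable.
  - by move=> x; exact: normr_ge0.
have iV : P.-integrable setT (EFin \o V).
  apply/integrableP; split; first exact/measurable_EFinP.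
  by rewrite Eabs ltry.
have Esq : (\int[P]_w (V w ^+ 2)%:E = (r + r ^+ 2)%:E)%E.
  rewrite (formula (fun x => x ^+ 2)).
  - under eq_eseriesr do rewrite expr2.
    rewrite (@nneseries_poisson_pmf_shift _ r (fun k => k%:R))//.
    under eq_eseriesr do rewrite -natr1 mulrDl mul1r -[X in X * _]mulr1 EFinD.
    rewrite nneseriesD; last 2 first.
    + by move=> k _ _; rewrite lee_fin !mulr_ge0// poisson_pmf_ge0.
    + by move=> k _ _; rewrite lee_fin poisson_pmf_ge0.
    rewrite (@nneseries_poisson_pmf_shift _ r (fun=> 1))//.
    under eq_eseriesr do rewrite mul1r.
    by rewrite nneseries_poisson_pmf// mule1 -EFinD -EFinM; congr EFin; ring.
  - exact: measurable_funX.
  - by move=> x; exact: sqr_ge0.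
split=> //; last by rewrite /Rintegral Esq.
(* The law charges nonnegative integers only, so [V] and [`|V|] have the same
   mean although [V] may be negative on a null set. *)
- have : \int[P]_w (`|V w| - V w) = 0.
    rewrite /Rintegral (formula (fun x => `|x| - x)).
    + by rewrite eseries0// => k _ _; rewrite normr_nat subrr mul0r.
    + by apply: measurable_funB => //; exact: normr_measurable.
    + by move=> x; rewrite subr_ge0 ler_norm.
  rewrite RintegralB//; last exact: (integrable_norm iV).
  by rewrite {1}/Rintegral Eabs /= => /eqP; rewrite subr_eq0 => /eqP <-.
- apply/integrableP; split; first exact/measurable_EFinP/measurable_funX.
  under eq_integral do rewrite /= ger0_norm ?sqr_ge0//.
  by rewrite Esq ltry.
Qed.

(** * Measurability with respect to the past *)

Section measurable_wrt_theory.
Context {R : realType} {d : measure_display} {T : measurableType d}.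
Implicit Types (G : set (set T)) (X Y : T -> R).

Lemma measurable_wrt_sub G G' X :
  G `<=` G' -> measurable_wrt G X -> measurable_wrt G' X.
Proof. by move=> GG' mX B mB; exact/GG'/mX. Qed.

Lemma measurable_wrt_measurable G X :
  G `<=` measurable -> measurable_wrt G X -> measurable_fun setT X.
Proof. by move=> Gm mX _ B mB; rewrite setTI; exact/Gm/mX. Qed.

Lemma measurable_wrt_comp G X (f : R -> R) : measurable_fun setT f ->
  measurable_wrt G X -> measurable_wrt G (f \o X).
Proof.
move=> mf mX B mB; apply: (mX (f @^-1` B)).
by rewrite -[_ @^-1` _]setTI; exact: mf.
Qed.

(** Makes the measurability of sums and products available for a sub-sigma-algebra
    of the ambient one. *)
Lemma measurable_wrtP G X : sigma_algebra setT G ->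
  measurable_wrt G X <->
  measurable_fun setT (X : g_sigma_algebraType G -> R).
Proof.
move=> sG; split=> [mX _ B mB|mX B mB].
  by rewrite setTI; apply: sub_gen_smallest; exact: mX.
rewrite -[G](sigma_algebra_id sG) -[X in _ X]setTI.
exact: mX.
Qed.

Lemma measurable_wrtD G X Y : sigma_algebra setT G -> measurable_wrt G X ->
  measurable_wrt G Y -> measurable_wrt G (fun w => X w + Y w).
Proof.
move=> sG /(measurable_wrtP _ sG) mX /(measurable_wrtP _ sG) mY.
exact/(measurable_wrtP _ sG)/measurable_funD.
Qed.

Lemma measurable_wrtM G X Y : sigma_algebra setT G -> measurable_wrt G X ->
  measurable_wrt G Y -> measurable_wrt G (fun w => X w * Y w).
Proof.
move=> sG /(measurable_wrtP _ sG) mX /(measurable_wrtP _ sG) mY.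
exact/(measurable_wrtP _ sG)/measurable_funM.
Qed.

Lemma independent_of_comp (P : probability T R) G X (f : R -> R) :
  measurable_fun setT f -> independent_of P G X -> independent_of P G (f \o X).
Proof.
move=> mf indX A B GA mB; apply: (indX A (f @^-1` B)) => //.
by rewrite -[X in measurable X]setTI; exact: mf.
Qed.

End measurable_wrt_theory.

Lemma increment_measurable_wrt (R : realType) (d : measure_display)
    (T : measurableType d) (F : R -> set (set T)) (Z : R -> T -> R) (s t : R) :
  filtration F -> adapted F Z -> 0 <= s -> s <= t ->
  measurable_wrt (F t) (increment Z s t).
Proof.
move=> Ff aZ s0 st; have t0 := le_trans s0 st.
have -> : increment Z s t = fun w => Z t w + (-%R \o Z s) w by [].
apply: measurable_wrtD; first exact: filtration_sigma.
  exact: aZ.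
apply: measurable_wrt_comp => //.
exact: measurable_wrt_sub (filtration_le Ff s0 st) (aZ s s0).
Qed.

Lemma increment_split (R : realType) (d : measure_display)
    (T : measurableType d) (Z : R -> T -> R) (s t u : R) (w : T) :
  increment Z s u w = increment Z s t w + increment Z t u w.
Proof. by rewrite /increment; ring. Qed.

(** The hypothesis on [v] holds for integers. When [|u| <= e] it gives the bound
    directly; otherwise [|u v|] is at most [u ^ 2 / e + e v ^ 2] and
    [u ^ 2 / e] is at most [u ^ 4 / e ^ 3]. *)
Lemma normM_le_quartic (R : realType) (e u v : R) : 0 < e -> `|v| <= v ^+ 2 ->
  `|u * v| <= u ^+ 4 / e ^+ 3 + e * v ^+ 2.
Proof.
move=> e0 hv.
have bound (a b : R) : 0 <= a -> 0 <= b -> b <= b ^+ 2 ->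
    a * b <= a ^+ 4 / e ^+ 3 + e * b ^+ 2.
  move=> a0 b0 hb; have [ae|ea] := leP a e.
    apply: (@le_trans _ _ (e * b ^+ 2)).
      by apply: le_trans (ler_wpM2l (ltW e0) hb); exact: ler_wpM2r.
    by rewrite lerDr divr_ge0 ?exprn_ge0// ltW.
  have h1 : a * b <= a ^+ 2 / e + e * b ^+ 2.
    rewrite -(ler_pM2l e0) mulrDr [e * (_ / _)]mulrC divfK ?gt_eqF//.
    have := sqr_ge0 (a - e * b).
    have : 0 <= a * (e * b) by rewrite !mulr_ge0// ltW.
    nra.
  apply: le_trans h1 _; rewrite lerD2r.
  have -> : a ^+ 4 / e ^+ 3 = (a ^+ 2 / e) * (a ^+ 2 / e ^+ 2).
    by field; rewrite gt_eqF.
  rewrite ler_peMr//; first by rewrite divr_ge0 ?exprn_ge0// ltW.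
  by rewrite ler_pdivlMr ?exprn_gt0// mul1r lerXn2r// ?nnegrE// ltW.
rewrite normrM.
have -> : u ^+ 4 = `|u| ^+ 4 by rewrite -normrX ger0_norm// exprn_even_ge0.
rewrite -(@real_normK _ v) ?num_real//.
by apply: bound => //; rewrite real_normK ?num_real.
Qed.

(** * Increments weighted by the past *)

Section increments.
Context {R : realType} {d : measure_display} {T : measurableType d}.
Variables (P : probability T R) (F : R -> set (set T)).
Variables (W : R -> T -> R) (N : R -> T -> nat) (lambda : R).
Hypothesis lambda0 : 0 < lambda.
Hypothesis Ff : filtration F.
Hypothesis BW : brownian_motion P F W.
Hypothesis PN : poisson_process P F lambda N.

Let V := real_valued N.

Let Fm t : 0 <= t -> F t `<=` measurable.
Proof. exact: filtration_sub. Qed.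

Lemma brownian_increment_moments s t : 0 <= s -> s < t ->
  let U := increment W s t in
  [/\ P.-integrable setT (EFin \o U) /\ \int[P]_w U w = 0,
      P.-integrable setT (EFin \o (fun w => U w ^+ 2)) /\
        \int[P]_w (U w ^+ 2) <= t - s &
      P.-integrable setT (EFin \o (fun w => U w ^+ 4)) /\
        \int[P]_w (U w ^+ 4) <= expR 8 * (t - s) ^+ 2].
Proof.
move=> s0 st U; have ts0 : 0 < t - s by rewrite subr_gt0.
have mU : measurable_fun setT U.
  apply: measurable_wrt_measurable (Fm (le_trans s0 (ltW st))) _.
  exact: increment_measurable_wrt (brownian_adapted BW) s0 (ltW st).
have sq : Num.sqrt (t - s) ^+ 2 = t - s by rewrite sqr_sqrtr// ltW.
have sq0 : 0 < Num.sqrt (t - s) by rewrite sqrtr_gt0.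
have := gaussian_moments sq0 mU (brownian_normal BW s0 st).
by rewrite [_ ^+ 4](exprM _ 2 2) sq.
Qed.

Lemma poisson_increment_moments s t : 0 <= s -> s < t ->
  let K := increment V s t in
  [/\ P.-integrable setT (EFin \o K), \int[P]_w K w = lambda * (t - s),
      P.-integrable setT (EFin \o (fun w => K w ^+ 2)) &
      \int[P]_w (K w ^+ 2) = lambda * (t - s) + (lambda * (t - s)) ^+ 2].
Proof.
move=> s0 st K; apply: poisson_moments.
- by rewrite mulr_gt0// subr_gt0.
- apply: measurable_wrt_measurable (Fm (le_trans s0 (ltW st))) _.
  exact: increment_measurable_wrt (poisson_adapted PN) s0 (ltW st).
- exact: (poisson_law PN s0 st).
Qed.

(** An increment of a counting process is an integer. *)
Lemma abs_poisson_increment_le_sqr s t w :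
  `|increment V s t w| <= increment V s t w ^+ 2.
Proof.
rewrite /increment /V /real_valued.
have -> : (N t w)%:R - (N s w)%:R = ((N t w)%:Z - (N s w)%:Z)%:~R :> R.
  by rewrite intrB !pmulrn.
move: (_ - _)%Z => z; rewrite -intr_norm -rmorphXn /= ler_int.
have [->|z0] := eqVneq z 0; first by rewrite normr0 expr0n.
by rewrite -[z ^+ 2]real_normK ?num_real// expr2 ler_peMl// -gtz0_ge1 normr_gt0.
Qed.

Lemma integral_indep_comp (Z : R -> T -> R) s t (Y : T -> R) (f : R -> R) :
  increments_independent_of_past P F Z ->
  0 <= s -> s < t -> measurable_wrt (F s) Y -> measurable_fun setT f ->
  P.-integrable setT (EFin \o Y) ->
  P.-integrable setT (EFin \o (f \o increment Z s t)) ->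
  P.-integrable setT (EFin \o (fun w => Y w * f (increment Z s t w))) /\
  \int[P]_w (Y w * f (increment Z s t w)) =
    (\int[P]_w Y w) * (\int[P]_w f (increment Z s t w)).
Proof.
move=> indZ s0 st mY mf iY iZ.
apply: (independent_integrableM (Fm s0) mY _ iY iZ).
exact: independent_of_comp mf (indZ s t s0 st).
Qed.

Section weighted.
Variables (s : R) (Y : T -> R).
Hypotheses (s0 : 0 <= s) (mY : measurable_wrt (F s) Y)
  (iY : P.-integrable setT (EFin \o Y)).

Lemma integrable_weighted_brownian t : s < t ->
  P.-integrable setT (EFin \o (fun w => Y w * increment W s t w)) /\
  \int[P]_w (Y w * increment W s t w) = 0.
Proof.
move=> st; have [[iU EU] _ _] := brownian_increment_moments s0 st.
have [iYU ->] := integral_indep_comp (brownian_indep BW) s0 st mY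
  (@measurable_id _ _ setT) iY iU.
by rewrite EU mulr0.
Qed.

Lemma integrable_weighted_brownian_sqr t : s < t ->
  P.-integrable setT (EFin \o (fun w => Y w * increment W s t w ^+ 2)) /\
  \int[P]_w (Y w * increment W s t w ^+ 2) =
    \int[P]_w Y w * \int[P]_w (increment W s t w ^+ 2).
Proof.
move=> st; have [_ [iU _] _] := brownian_increment_moments s0 st.
exact: (integral_indep_comp (f := fun x => x ^+ 2) (brownian_indep BW)).
Qed.

Lemma integrable_weighted_poisson t : s < t ->
  P.-integrable setT (EFin \o (fun w => Y w * increment V s t w)) /\
  \int[P]_w (Y w * increment V s t w) = \int[P]_w Y w * (lambda * (t - s)).
Proof.
move=> st; have [iK EK _ _] := poisson_increment_moments s0 st.
have [iYK ->] := integral_indep_comp (poisson_indep PN) s0 st mY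
  (@measurable_id _ _ setT) iY iK.
by rewrite EK.
Qed.

Lemma integrable_weighted_poisson_sqr t : s < t ->
  P.-integrable setT (EFin \o (fun w => Y w * increment V s t w ^+ 2)) /\
  \int[P]_w (Y w * increment V s t w ^+ 2) =
    \int[P]_w Y w * (lambda * (t - s) + (lambda * (t - s)) ^+ 2).
Proof.
move=> st; have [_ _ iK EK] := poisson_increment_moments s0 st.
rewrite -EK.
exact: (integral_indep_comp (f := fun x => x ^+ 2) (poisson_indep PN)).
Qed.

End weighted.

(** * Vanishing covariation of the two noises *)

Lemma integrable_normr_wrt s (Y : T -> R) : measurable_wrt (F s) Y ->
  P.-integrable setT (EFin \o Y) ->
  measurable_wrt (F s) (fun w => `|Y w|) /\
  P.-integrable setT (EFin \o (fun w => `|Y w|)).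
Proof.
move=> mY iY; split; last exact: integrable_norm iY.
apply: (measurable_wrt_comp (f := fun x => `|x|) _ mY).
exact: normr_measurable.
Qed.

Lemma integrable_weighted_product s t (Y : T -> R) : 0 <= s -> s < t ->
  measurable_wrt (F s) Y -> P.-integrable setT (EFin \o Y) ->
  P.-integrable setT
    (EFin \o (fun w => Y w * (increment W s t w * increment V s t w))).
Proof.
move=> s0 st mY iY.
have [mA iA] := integrable_normr_wrt mY iY.
have [iU _] := integrable_weighted_brownian_sqr s0 mA iA st.
have [iK _] := integrable_weighted_poisson_sqr s0 mA iA st.
have t0 := le_trans s0 (ltW st).
apply: dominated_integrable (integrable_addr iU iK) _.
  apply: measurable_funM; first exact: integrable_measurable iY.
  by apply: measurable_funM;
    apply: (measurable_wrt_measurable (Fm t0));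
    apply: increment_measurable_wrt => //; rewrite ?(ltW st)//;
    [exact: brownian_adapted BW|exact: poisson_adapted PN].
move=> w; rewrite normrM -mulrDr ler_wpM2l// normrM.
rewrite -[_ ^+ 2]real_normK ?num_real// -[X in _ + X]real_normK ?num_real//.
have := sqr_ge0 (`|increment W s t w| - `|increment V s t w|).
have := normr_ge0 (increment W s t w); have := normr_ge0 (increment V s t w).
nra.
Qed.

(** For a suitable [e] depending on [t - s], the right-hand side is of smaller
    order than [t - s]. *)
Lemma integral_weighted_product_le s t (Y : T -> R) (e : R) :
  0 <= s -> s < t -> 0 < e ->
  measurable_wrt (F s) Y -> P.-integrable setT (EFin \o Y) ->
  `|\int[P]_w (Y w * (increment W s t w * increment V s t w))| <=
  \int[P]_w `|Y w| * (expR 8 * (t - s) ^+ 2 / e ^+ 3 +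
    e * (lambda * (t - s) + (lambda * (t - s)) ^+ 2)).
Proof.
move=> s0 st e0 mY iY.
have [mA iA] := integrable_normr_wrt mY iY.
have [_ _ [iU4 EU4]] := brownian_increment_moments s0 st.
have [iAU EAU] := integral_indep_comp (f := fun x => x ^+ 4)
  (brownian_indep BW) s0 st mA (exprn_measurable 4) iA iU4.
have [iAK EAK] := integrable_weighted_poisson_sqr s0 mA iA st.
have iP := integrable_weighted_product s0 st mY iY.
apply: le_trans (le_normr_Rintegral measurableT iP) _.
apply: (@le_trans _ _ (\int[P]_w (e ^- 3 * (`|Y w| * increment W s t w ^+ 4) +
    e * (`|Y w| * increment V s t w ^+ 2)))).
  apply: le_Rintegral => //.
  - exact: integrable_norm iP.
  - by apply: integrable_addr; exact: integrable_scaler.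
  - move=> w _; rewrite normrM.
    have := normM_le_quartic (increment W s t w) e0
      (abs_poisson_increment_le_sqr s t w).
    by move=> /(ler_wpM2l (normr_ge0 (Y w))); rewrite mulrDr; lra.
rewrite RintegralD//; [|exact: integrable_scaler|exact: integrable_scaler].
rewrite !RintegralZl// EAU EAK.
have A0 : 0 <= \int[P]_w `|Y w| by apply: Rintegral_ge0.
have B0 : 0 <= e ^- 3 * \int[P]_w `|Y w|.
  by rewrite mulr_ge0// invr_ge0 exprn_ge0// ltW.
have := ler_wpM2l B0 EU4; lra.
Qed.

(** The mixed terms [Y U K'] and [Y K U'], with [U'], [K'] the increments over the
    second interval, have mean zero: the first because the past weight [Y U] is
    centred, the second because [U'] is. *)
Lemma integral_weighted_product_split s t u (Y : T -> R) :
  0 <= s -> s < t -> t < u ->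
  measurable_wrt (F s) Y -> P.-integrable setT (EFin \o Y) ->
  \int[P]_w (Y w * (increment W s u w * increment V s u w)) =
  \int[P]_w (Y w * (increment W s t w * increment V s t w)) +
  \int[P]_w (Y w * (increment W t u w * increment V t u w)).
Proof.
move=> s0 st tu mY iY; have t0 := le_trans s0 (ltW st).
have sig := filtration_sigma Ff t0.
have mYt : measurable_wrt (F t) Y.
  exact: measurable_wrt_sub (filtration_le Ff s0 (ltW st)) mY.
have [iYU EYU] := integrable_weighted_brownian s0 mY iY st.
have [iYK EYK] := integrable_weighted_poisson s0 mY iY st.
have mYU : measurable_wrt (F t) (fun w => Y w * increment W s t w).
  apply: measurable_wrtM => //.
  exact: increment_measurable_wrt (brownian_adapted BW) s0 (ltW st).
have mYK : measurable_wrt (F t) (fun w => Y w * increment V s t w).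
  apply: measurable_wrtM => //.
  exact: increment_measurable_wrt (poisson_adapted PN) s0 (ltW st).
have [iUK EUK] := integrable_weighted_poisson t0 mYU iYU tu.
have [iKU EKU] := integrable_weighted_brownian t0 mYK iYK tu.
have i1 := integrable_weighted_product s0 st mY iY.
have i2 := integrable_weighted_product t0 tu mYt iY.
transitivity (\int[P]_w (
    (Y w * (increment W s t w * increment V s t w) +
     Y w * (increment W t u w * increment V t u w)) +
    (Y w * increment W s t w * increment V t u w +
     Y w * increment V s t w * increment W t u w))).
  apply: eq_Rintegral => w _.
  by rewrite !(increment_split _ s t u); ring.
rewrite RintegralD//; [|exact: integrable_addr|exact: integrable_addr].
by rewrite RintegralD// [X in _ + X]RintegralD// EUK EKU EYU mul0r !addr0.
Qed.

Lemma integral_weighted_product_partition s t h n (Y : T -> R) (e : R) :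
  0 <= s -> 0 < h -> 0 < e ->
  measurable_wrt (F s) Y -> P.-integrable setT (EFin \o Y) ->
  t = s + n.+1%:R * h ->
  `|\int[P]_w (Y w * (increment W s t w * increment V s t w))| <=
  n.+1%:R * (\int[P]_w `|Y w| * (expR 8 * h ^+ 2 / e ^+ 3 +
    e * (lambda * h + (lambda * h) ^+ 2))).
Proof.
move=> + h0 e0; elim: n s => [|n ih] s s0 mY iY tE.
  have sh : s < s + h by rewrite ltrDl.
  have := integral_weighted_product_le s0 sh e0 mY iY.
  by rewrite tE !mul1r [s + h - s]addrAC subrr add0r.
have sh : s < s + h by rewrite ltrDl.
have sh0 := le_trans s0 (ltW sh).
have mYh : measurable_wrt (F (s + h)) Y.
  exact: measurable_wrt_sub (filtration_le Ff s0 (ltW sh)) mY.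
have tE' : t = s + h + n.+1%:R * h by rewrite tE -[n.+2%:R]nat1r; ring.
have ht : s + h < t by rewrite tE' ltrDl mulr_gt0.
rewrite (integral_weighted_product_split s0 sh ht mY iY).
apply: le_trans (ler_normD _ _) _.
rewrite -[n.+2%:R]nat1r mulrDl mul1r; apply: lerD; last first.
  exact: ih.
have := integral_weighted_product_le s0 sh e0 mY iY.
by rewrite [s + h - s]addrAC subrr add0r.
Qed.

(** The partition bound tends to a multiple of [e] when the number of pieces
    grows, and [e] is arbitrary. *)
Lemma integral_weighted_product_eq0 s t (Y : T -> R) : 0 <= s -> s < t ->
  measurable_wrt (F s) Y -> P.-integrable setT (EFin \o Y) ->
  \int[P]_w (Y w * (increment W s t w * increment V s t w)) = 0.
Proof.
move=> s0 st mY iY; apply/eqP; rewrite -normr_le0.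
set phi := `| _ |; set M := \int[P]_w `|Y w|.
have M0 : 0 <= M by apply: Rintegral_ge0.
have ts0 : 0 < t - s by rewrite subr_gt0.
set D := t - s in ts0.
pose C := M * (expR 8 * D ^+ 2 + lambda * D + (lambda * D) ^+ 2).
have C0 : 0 <= C.
  by rewrite mulr_ge0// !addr_ge0 ?mulr_ge0 ?expR_ge0 ?sqr_ge0// ltW.
suff bound e : 0 < e -> phi <= C * e.
  apply/ler_addgt0Pr => e e0; rewrite add0r.
  have C1 : 0 < C + 1 by rewrite ltr_wpDl.
  apply: le_trans (bound (e / (C + 1)) _) _; first by rewrite divr_gt0.
  by rewrite mulrCA ler_piMr ?(ltW e0)// ler_pdivrMr// mul1r lerDl.
(* This many pieces make [e ^- 3 / n] at most [e]. *)
move=> e0; pose n := Num.bound (e ^- 4).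
have ne : e ^- 4 <= n.+1%:R.
  have n0 : 0 <= e ^- 4 by rewrite invr_ge0 exprn_ge0// ltW.
  by apply: le_trans (ltW (archi_boundP n0)) _; rewrite ler_nat.
have hn0 : 0 < n.+1%:R :> R by [].
have h0 : 0 < D / n.+1%:R by rewrite divr_gt0.
have tE : t = s + n.+1%:R * (D / n.+1%:R).
  by rewrite mulrC divfK ?gt_eqF// subrKC.
apply: le_trans (integral_weighted_product_partition s0 h0 e0 mY iY tE) _.
rewrite -/M.
rewrite mulrCA /C -[leRHS]mulrA ler_wpM2l//.
move: ne; set m := n.+1%:R in hn0 h0 *; move=> ne.
have -> : m * (expR 8 * (D / m) ^+ 2 / e ^+ 3 +
      e * (lambda * (D / m) + (lambda * (D / m)) ^+ 2)) =
    expR 8 * D ^+ 2 * (e ^- 3 / m) + e * (lambda * D) + e * (lambda * D) ^+ 2 / m.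
  by field; rewrite !gt_eqF.
rewrite !mulrDl ?lerD//.
- apply: ler_wpM2l; first by rewrite mulr_ge0 ?expR_ge0 ?sqr_ge0.
  rewrite ler_pdivrMr//.
  rewrite -(ler_pM2l e0) in ne.
  have <- : e * e ^- 4 = e ^- 3 by field; rewrite gt_eqF.
  by [].
- by rewrite mulrC.
- rewrite [leRHS]mulrC ler_pdivrMr// ler_peMr ?(mulr_ge0 (ltW e0) (sqr_ge0 _))//.
  by rewrite /m ler1n.
Qed.

End increments.

(** * Mean-square contraction of the scheme *)

Section one_step.
Context {R : realType} {d : measure_display} {T : measurableType d}.
Variables (P : probability T R) (F : R -> set (set T)).
Variables (W : R -> T -> R) (N : R -> T -> nat) (lambda : R).
Hypothesis lambda0 : 0 < lambda.
Hypothesis Ff : filtration F.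
Hypothesis BW : brownian_motion P F W.
Hypothesis PN : poisson_process P F lambda N.

(** The mean of the squared step; the inequality comes only from bounding the
    second moment of the Brownian increment by [t - s]. *)
Lemma second_moment_step (s t b c : R) (G X : T -> R) :
  0 <= s -> s < t -> measurable_wrt (F s) G -> measurable_wrt (F s) X ->
  P.-integrable setT (EFin \o (fun w => G w ^+ 2)) ->
  P.-integrable setT (EFin \o (fun w => X w ^+ 2)) ->
  let r := lambda * (t - s) in
  let X' w := G w + b * X w * increment W s t w +
    c * X w * increment (real_valued N) s t w in
  let bound w := G w ^+ 2 +
    (b ^+ 2 * (t - s) + c ^+ 2 * (r + r ^+ 2)) * X w ^+ 2 +
    2 * c * r * (G w * X w) in
  [/\ P.-integrable setT (EFin \o (fun w => X' w ^+ 2)),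
      P.-integrable setT (EFin \o bound) &
      \int[P]_w (X' w ^+ 2) <= \int[P]_w bound w].
Proof.
move=> s0 st mG mX iG2 iX2 r X' bound.
have sig := filtration_sigma Ff s0.
have mT Z : measurable_wrt (F s) Z -> measurable_fun setT Z.
  by apply: measurable_wrt_measurable; exact: filtration_sub.
have mX2 : measurable_wrt (F s) (fun w => X w ^+ 2).
  exact: measurable_wrt_comp (exprn_measurable 2) mX.
have mGX : measurable_wrt (F s) (fun w => G w * X w) by exact: measurable_wrtM.
have iGX : P.-integrable setT (EFin \o (fun w => G w * X w)).
  apply: dominated_integrable (integrable_addr iG2 iX2) _; first exact: mT.
  move=> w; rewrite normrM -(@real_normK _ (G w)) ?num_real//.
  rewrite -(@real_normK _ (X w)) ?num_real//.
  have := sqr_ge0 (`|G w| - `|X w|).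
  have := normr_ge0 (G w); have := normr_ge0 (X w); nra.
have [i1 E1] := integrable_weighted_brownian Ff BW s0 mGX iGX st.
have [i2 E2] := integrable_weighted_poisson lambda0 Ff PN s0 mGX iGX st.
have [i3 E3] := integrable_weighted_brownian_sqr Ff BW s0 mX2 iX2 st.
have [i4 E4] := integrable_weighted_poisson_sqr lambda0 Ff PN s0 mX2 iX2 st.
have i5 := integrable_weighted_product lambda0 Ff BW PN s0 st mX2 iX2.
have E5 := integral_weighted_product_eq0 lambda0 Ff BW PN s0 st mX2 iX2.
have [_ [_ EU] _] := brownian_increment_moments Ff BW s0 st.
set U := increment W s t in i1 E1 i3 E3 i5 E5 EU X' *.
set K := increment (real_valued N) s t in i2 E2 i4 E4 i5 E5 X' *.
have X'E w : X' w ^+ 2 = G w ^+ 2 + b ^+ 2 * (X w ^+ 2 * U w ^+ 2) +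
    c ^+ 2 * (X w ^+ 2 * K w ^+ 2) + (2 * b) * (G w * X w * U w) +
    (2 * c) * (G w * X w * K w) + (2 * b * c) * (X w ^+ 2 * (U w * K w)).
  by rewrite /X'; ring.
have ib : P.-integrable setT (EFin \o bound).
  apply: integrable_addr; last exact: integrable_scaler.
  by apply: integrable_addr => //; exact: integrable_scaler.
have iZ k f : P.-integrable setT (EFin \o f) ->
    P.-integrable setT (EFin \o (fun w => k * f w)).
  exact: integrable_scaler.
have iD f g : P.-integrable setT (EFin \o f) ->
    P.-integrable setT (EFin \o g) ->
    P.-integrable setT (EFin \o (fun w => f w + g w)).
  exact: integrable_addr.
split=> //.
  under eq_fun do rewrite X'E.
  by do 5 (apply: (iD); last exact: iZ).
have -> : \int[P]_w (X' w ^+ 2) = \int[P]_w (G w ^+ 2) +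
    b ^+ 2 * (\int[P]_w (X w ^+ 2) * \int[P]_w (U w ^+ 2)) +
    c ^+ 2 * (\int[P]_w (X w ^+ 2) * (r + r ^+ 2)) +
    2 * c * (\int[P]_w (G w * X w) * r).
  under eq_Rintegral do rewrite X'E.
  rewrite RintegralD//; [|by do 4 (apply: (iD); last exact: iZ)|exact: iZ].
  rewrite RintegralD//; [|by do 3 (apply: (iD); last exact: iZ)|exact: iZ].
  rewrite RintegralD//; [|by do 2 (apply: (iD); last exact: iZ)|exact: iZ].
  rewrite RintegralD//; [|by do 1 (apply: (iD); last exact: iZ)|exact: iZ].
  rewrite RintegralD//; [|exact: iZ].
  rewrite !RintegralZl// E1 E2 E3 E4 E5 -/r; ring.
rewrite /bound RintegralD//; [|by apply: (iD) => //; exact: iZ|exact: iZ].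
rewrite RintegralD//; [|exact: iZ].
rewrite !RintegralZl//.
have m0 : 0 <= b ^+ 2 * \int[P]_w (X w ^+ 2).
  by rewrite mulr_ge0 ?sqr_ge0// Rintegral_ge0// => w _; exact: sqr_ge0.
have := ler_wpM2l m0 EU; lra.
Qed.

End one_step.

(** With [th] the taming number, the left-hand side of the conclusion is
    [1 + (l - 2 a) dt + 2 dt a (1 + lambda c dt) th + a ^ 2 dt ^ 2 th ^ 2 +
    lambda ^ 2 c ^ 2 dt ^ 2]. The sign of [a (1 + lambda c dt)] decides whether
    its linear term is worst at [th = 0] or at [th = 1]; bounding the quadratic
    term by its value at [1] gives the two thresholds for [dt]. *)
Lemma amplification_lt1 (R : realType) (a b c lambda dt : R) :
  let l := 2 * a + b ^+ 2 + lambda * c * (2 + c) in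
  l < 0 -> 0 < dt ->
  [/\ a * (1 + lambda * c * dt) <= 0, 0 < 2 * a - l
    & dt < (2 * a - l) / (a ^+ 2 + lambda ^+ 2 * c ^+ 2)] \/
  (0 < a * (1 + lambda * c * dt) /\ dt < - l / (a + lambda * c) ^+ 2) ->
  exists2 L : R, 0 < L < 1 & forall th : R, 0 <= th <= 1 ->
    (1 + a * dt * th) ^+ 2 +
    (b ^+ 2 * dt + c ^+ 2 * (lambda * dt + (lambda * dt) ^+ 2)) +
    2 * c * (lambda * dt) * (1 + a * dt * th) <= L.
Proof.
move=> l l0 dt0 H.
have expand th : (1 + a * dt * th) ^+ 2 +
    (b ^+ 2 * dt + c ^+ 2 * (lambda * dt + (lambda * dt) ^+ 2)) +
    2 * c * (lambda * dt) * (1 + a * dt * th) =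
    1 + (l - 2 * a) * dt + 2 * dt * (a * (1 + lambda * c * dt)) * th +
    a ^+ 2 * dt ^+ 2 * th ^+ 2 + lambda ^+ 2 * c ^+ 2 * dt ^+ 2.
  by rewrite /l; ring.
have [M M1 HM] : exists2 M : R, M < 1 & forall th : R, 0 <= th <= 1 ->
    1 + (l - 2 * a) * dt + 2 * dt * (a * (1 + lambda * c * dt)) * th +
    a ^+ 2 * dt ^+ 2 * th ^+ 2 + lambda ^+ 2 * c ^+ 2 * dt ^+ 2 <= M.
  have adt0 : 0 <= a ^+ 2 * dt ^+ 2 by rewrite mulr_ge0 ?sqr_ge0.
  have th2 (th : R) : 0 <= th <= 1 ->
      a ^+ 2 * dt ^+ 2 * th ^+ 2 <= a ^+ 2 * dt ^+ 2.
    by move=> /andP[h0 h1]; rewrite ler_piMr// expr_le1.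
  (* A vanishing denominator would make the stepsize bound equal to 0. *)
  have pos (x y : R) : 0 <= y -> dt < x / y -> dt * y < x.
    rewrite le_eqVlt => /orP[/eqP <-|y0]; last by rewrite ltr_pdivlMr.
    by rewrite invr0 mulr0 => h; have := lt_trans dt0 h; rewrite ltxx.
  case: H => [[s1 s2 s3]|[s1 s2]].
  - exists (1 + (l - 2 * a) * dt + (a ^+ 2 + lambda ^+ 2 * c ^+ 2) * dt ^+ 2).
      have /pos/(_ s3) : 0 <= a ^+ 2 + lambda ^+ 2 * c ^+ 2.
        by rewrite addr_ge0 ?sqr_ge0// mulr_ge0 ?sqr_ge0.
      by rewrite -(ltr_pM2l dt0); lra.
    move=> th h; have := th2 _ h; case/andP: h => h0 h1.
    have : 2 * dt * (a * (1 + lambda * c * dt)) * th <= 0.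
      by rewrite mulr_le0_ge0// mulr_ge0_le0// mulr_ge0// ltW.
    lra.
  - exists (1 + l * dt + (a + lambda * c) ^+ 2 * dt ^+ 2).
      have /pos/(_ s2) : 0 <= (a + lambda * c) ^+ 2 by exact: sqr_ge0.
      by rewrite -(ltr_pM2l dt0); lra.
    move=> th h; have := th2 _ h; case/andP: h => h0 h1.
    have : 2 * dt * (a * (1 + lambda * c * dt)) * th <=
        2 * dt * (a * (1 + lambda * c * dt)).
      by rewrite ler_piMr// ltW// mulr_gt0// mulr_gt0.
    lra.
(* The maximum makes the constant positive. *)
exists (Num.max M 2^-1).
  by rewrite lt_max gt_max M1 invr_gt0 ltr0n orbT invf_lt1// ltr1n.
by move=> th h; rewrite expand le_max HM.
Qed.

Definition tamed_factor {R : realType} (a dt x : R) : R :=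
  1 + a * dt * (1 + dt * `|a * x|)^-1.

Lemma taming_itv (R : realType) (a dt x : R) : 0 < dt ->
  0 <= (1 + dt * `|a * x|)^-1 <= 1.
Proof.
move=> dt0; have D1 : 1 <= 1 + dt * `|a * x|.
  by rewrite lerDl mulr_ge0// ltW.
by rewrite invr_ge0 (le_trans ler01 D1)/= invf_le1// (lt_le_trans ltr01 D1).
Qed.

Lemma measurable_tamed_factor (R : realType) (a dt : R) : 0 < dt ->
  measurable_fun setT (tamed_factor a dt).
Proof.
move=> dt0; apply: measurable_funD => //; apply: measurable_funM => //.
apply: continuous_measurable_fun => x.
apply: cvgV.
  rewrite gt_eqF// (lt_le_trans ltr01)// lerDl mulr_ge0// ltW//.
apply: cvgD; first exact: cvg_cst.
apply: cvgM; first exact: cvg_cst.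
apply: cvg_norm; apply: cvgM; first exact: cvg_cst.
exact: cvg_id.
Qed.

Section tamed_scheme.
Context {R : realType} {d : measure_display} {T : measurableType d}.
Variables (P : probability T R) (F : R -> set (set T)).
Variables (W : R -> T -> R) (N : R -> T -> nat) (a b c lambda dt : R).
Hypothesis lambda0 : 0 < lambda.
Hypothesis Ff : filtration F.
Hypothesis BW : brownian_motion P F W.
Hypothesis PN : poisson_process P F lambda N.
Hypothesis dt0 : 0 < dt.

Lemma tamed_euler_second_moment_step (L : R) (X0 : T -> R) n :
  (forall th : R, 0 <= th <= 1 ->
    (1 + a * dt * th) ^+ 2 +
    (b ^+ 2 * dt + c ^+ 2 * (lambda * dt + (lambda * dt) ^+ 2)) +
    2 * c * (lambda * dt) * (1 + a * dt * th) <= L) ->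
  let X := tamed_euler W N a b c dt X0 in
  measurable_wrt (F (n%:R * dt)) (X n) ->
  P.-integrable setT (EFin \o (fun w => X n w ^+ 2)) ->
  [/\ measurable_wrt (F (n.+1%:R * dt)) (X n.+1),
      P.-integrable setT (EFin \o (fun w => X n.+1 w ^+ 2)) &
      \int[P]_w (X n.+1 w ^+ 2) <= L * \int[P]_w (X n w ^+ 2)].
Proof.
move=> HL X mX iX.
have s0 : 0 <= n%:R * dt by rewrite mulr_ge0// ltW.
have st : n%:R * dt < n.+1%:R * dt by rewrite ltr_pM2r// ltr_nat.
have t0 := le_trans s0 (ltW st).
have tsE : n.+1%:R * dt - n%:R * dt = dt.
  by rewrite -natr1 mulrDl mul1r addrC addKr.
pose G w := X n w * tamed_factor a dt (X n w).
have sig := filtration_sigma Ff s0.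
have sig' := filtration_sigma Ff t0.
have mG : measurable_wrt (F (n%:R * dt)) G.
  apply: measurable_wrtM => //.
  exact: measurable_wrt_comp (measurable_tamed_factor a dt0) mX.
have mT Z : measurable_wrt (F (n%:R * dt)) Z -> measurable_fun setT Z.
  by apply: measurable_wrt_measurable; exact: filtration_sub.
have iG : P.-integrable setT (EFin \o (fun w => G w ^+ 2)).
  apply: dominated_integrable (integrable_scaler ((1 + `|a| * dt) ^+ 2) iX) _.
    exact/measurable_funX/mT.
  move=> w; rewrite /G exprMn ger0_norm ?(mulr_ge0 (sqr_ge0 _) (sqr_ge0 _))//.
  rewrite mulrC ler_wpM2r ?sqr_ge0// -real_normK ?num_real//.
  rewrite lerXn2r ?nnegrE ?addr_ge0 ?mulr_ge0// ?(ltW dt0)//.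
  apply: le_trans (ler_normD _ _) _; rewrite normr1 lerD2l.
  have /andP[] := taming_itv a (X n w) dt0.
  move: (1 + _)^-1 => th h0 h1; rewrite !normrM.
  by rewrite (ger0_norm (ltW dt0)) (ger0_norm h0) ler_piMr// mulr_ge0// ltW.
have [i1 i2 le12] := second_moment_step lambda0 Ff BW PN b c s0 st mG mX iG iX.
rewrite tsE in i1 i2 le12.
have XE : X n.+1 = fun w => G w +
    b * X n w * increment W (n%:R * dt) (n.+1%:R * dt) w +
    c * X n w * increment (real_valued N) (n%:R * dt) (n.+1%:R * dt) w.
  apply/funext => w; rewrite /X /= -/X /G /tamed_factor; congr (_ + _ + _).
  by rewrite mulrDr mulr1; congr (_ + _); ring.
split.
- have sub := measurable_wrt_sub (filtration_le Ff s0 (ltW st)).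
  have mU := increment_measurable_wrt Ff (brownian_adapted BW) s0 (ltW st).
  have mK := increment_measurable_wrt Ff (poisson_adapted PN) s0 (ltW st).
  have mcX k : measurable_wrt (F (n.+1%:R * dt)) (fun w => k * X n w).
    apply: sub; apply: (measurable_wrt_comp (f := fun x => k * x) _ mX).
    exact: measurable_funM.
  rewrite XE; apply: measurable_wrtD => //; last exact: measurable_wrtM.
  by apply: measurable_wrtD => //; [exact: sub|exact: measurable_wrtM].
- by rewrite XE.
- rewrite XE; apply: le_trans le12 _.
  rewrite -RintegralZl//; apply: le_Rintegral => //.
    exact: integrable_scaler.
  move=> w _; have := HL _ (taming_itv a (X n w) dt0).
  move=> /(ler_wpM2r (sqr_ge0 (X n w))).
  by rewrite /G /tamed_factor; lra.
Qed.

End tamed_scheme.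

Unset Implicit Arguments.

Theorem theorem5p5p4 (R : realType) (d : measure_display)
    (T : measurableType d) (P : probability T R) (F : R -> set (set T))
    (W : R -> T -> R) (N : R -> T -> nat) (a b c lambda dt : R) :
  let l := 2 * a + b ^+ 2 + lambda * c * (2 + c) in
  0 < lambda ->
  filtration F ->
  brownian_motion P F W ->
  poisson_process P F lambda N ->
  l < 0 ->
  0 < dt ->
  [/\ a * (1 + lambda * c * dt) <= 0, 0 < 2 * a - l
    & dt < (2 * a - l) / (a ^+ 2 + lambda ^+ 2 * c ^+ 2)] \/
  (0 < a * (1 + lambda * c * dt) /\ dt < - l / (a + lambda * c) ^+ 2) ->
  mean_square_stable P F (tamed_euler W N a b c dt).
Proof.
move=> l lambda0 Ff BW PN l0 dt0 /(amplification_lt1 l0 dt0)[L L01 HL].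
exists L; split=> // X0 mX0 EX0 n.
pose X := tamed_euler W N a b c dt X0.
have EE k : P.-integrable setT (EFin \o (fun w => X k w ^+ 2)) ->
    ('E_P[fun w => (`|X k w| ^+ 2)%R] = (\int[P]_w (X k w ^+ 2))%R%:E)%E.
  move=> iX; rewrite unlock /Rintegral fineK; last exact: integrable_fin_num.
  by apply: eq_integral => w _; rewrite real_normK ?num_real.
have inv k : measurable_wrt (F (k%:R * dt)) (X k) /\
    P.-integrable setT (EFin \o (fun w => X k w ^+ 2)).
  elim: k => [|k [mX iX]].
    rewrite mul0r; split=> //; apply/integrableP; split.
      apply/measurable_EFinP/measurable_funX.
      exact: measurable_wrt_measurable (filtration_sub Ff (lexx 0)) mX0.
    move: EX0; rewrite unlock; congr (_ < _)%E.
    by apply: eq_integral => w _ /=; rewrite normrX.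
  by have [] := tamed_euler_second_moment_step lambda0 Ff BW PN dt0 HL mX iX.
have [mX iX] := inv n.
have [_ iX' le] := tamed_euler_second_moment_step lambda0 Ff BW PN dt0 HL mX iX.
by rewrite (EE n.+1 iX') (EE n iX) -EFinM lee_fin.
Qed.
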